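(* There exist a family of databases $\{D_\ell\}_{\ell>0}$ and a family $\{\Sigma_{n,m}\}_{n,m>0}$ of finite sets of simple linear TGDs such that for all integers $\ell,n,m>0$: $|D_\ell|=\ell$, $n=|\mathsf{sch}(\Sigma_{n,m})|-1$, $m=\mathsf{ar}(\Sigma_{n,m})$, $\Sigma_{n,m}\in\mathsf{CT}_{D_\ell}$ (i.e., $\mathsf{chase}(D_\ell,\Sigma_{n,m})$ is finite), and $$|\mathsf{chase}(D_\ell,\Sigma_{n,m})|\ \ge\ \ell\cdot m^{n\cdot m}.$$
   Context: **Basics.** $\mathbf{C},\mathbf{N},\mathbf{V}$ are disjoint countably infinite sets of constants, nulls and variables; their elements are terms. A schema is a finite set of predicates, each with an arity $>0$. An atom is $R(\bar t)$ with $\bar t$ a tuple of terms of length the arity of $R$; a fact is an atom with only constants. An instance is a (possibly infinite) set of atoms over constants and nulls; a database is a finite set of facts. $|\cdot|$ is cardinality. A homomorphism from a set of atoms $A$ to a set of atoms $B$ maps terms of $A$ to terms of $B$, is the identity on $\mathbf{C}$, and maps atoms of $A$ to atoms of $B$. **TGDs.** A TGD $\sigma$ is a constant-free sentence $\forall\bar x\forall\bar y(\phi(\bar x,\bar y)\to\exists\bar z\,\psi(\bar x,\bar z))$ with $\phi$ (the body) and $\psi$ (the head) non-empty conjunctions of atoms over the variables $\bar x\cup\bar y$ and $\bar x\cup\bar z$; conjunctions are identified with sets of atoms. The frontier $\mathsf{fr}(\sigma)$ is the set of variables $\bar x$ occurring in both body and head. A TGD is simple linear if its body is a single atom in which no variable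 occurs more than once. For a finite set $\Sigma$ of TGDs, $\mathsf{sch}(\Sigma)$ is the set of predicates occurring in $\Sigma$ and $\mathsf{ar}(\Sigma)$ their maximum arity. **Semi-oblivious chase.** A trigger for $\Sigma$ on an instance $I$ is $(\sigma,h)$ with $\sigma\in\Sigma$ and $h$ a homomorphism from $\mathsf{body}(\sigma)$ to $I$. Its result $\mathsf{result}(\sigma,h)$ is $\mu(\mathsf{head}(\sigma))$, where $\mu(x)=h(x)$ if $x\in\mathsf{fr}(\sigma)$ and otherwise $\mu(x)$ is the null $\bot^x_{\sigma,h_{|\mathsf{fr}(\sigma)}}$, uniquely determined by $x$, $\sigma$ and the restriction of $h$ to $\mathsf{fr}(\sigma)$. The trigger is active if $\mathsf{result}(\sigma,h)\not\subseteq I$; applying it yields $I\cup\mathsf{result}(\sigma,h)$. A valid chase derivation of $D$ w.r.t. $\Sigma$ is a sequence of instances starting with $D$, each next one obtained by applying an active trigger, that is either finite with no active trigger on the last instance, or infinite and fair (every trigger active on some $I_i$ is not active on some later $I_j$). Its result is the union of its instances; all valid derivations have the same result, denoted $\mathsf{chase}(D,\Sigma)$. $\mathsf{CT}_D$ is the class of sets $\Sigma$ of TGDs such that $\mathsf{chase}(D,\Sigma)$ is finite. *)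

(* Defs.v *)
From HB Require Import structures.
From mathcomp Require Import all_boot finmap.
From mathcomp Require Import mathcomp_extra boolp classical_sets functions.
From mathcomp Require Import cardinality.

Set Implicit Arguments.
Unset Strict Implicit.
Unset Printing Implicit Defensive.

(* Terms: three disjoint countably infinite sets. *)
Inductive term : Type := Const of nat | Null of nat | Var of nat.

Definition term_code (t : term) : nat + nat + nat :=
  match t with
  | Const c => inl (inl c) | Null k => inl (inr k) | Var x => inr x
  end.
Definition term_decode (u : nat + nat + nat) : term :=
  match u with
  | inl (inl c) => Const c | inl (inr k) => Null k | inr x => Var x
  end.
Lemma term_codeK : cancel term_code term_decode.
Proof. by case. Qed.
HB.instance Definition _ := Countable.copy term (can_type term_codeK).

Definition is_const (t : term) : bool := if t is Const _ then true else false.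
Definition is_var (t : term) : bool := if t is Var _ then true else false.

(* The pair (i, k) is the i-th predicate of arity k + 1, so every arity is
   positive and every positive arity has infinitely many predicates. *)
Definition predicate : Type := (nat * nat)%type.
HB.instance Definition _ := Countable.on predicate.
Definition arity (p : predicate) : nat := p.2.+1.

Definition atom : Type := {p : predicate & (arity p).-tuple term}.
HB.instance Definition _ := Countable.on atom.
Definition apred (a : atom) : predicate := tag a.
Definition aargs (a : atom) : seq term := tval (tagged a).

Definition map_atom (f : term -> term) (a : atom) : atom :=
  Tagged (fun p => (arity p).-tuple term) [tuple of map f (tagged a)].

Definition is_fact (a : atom) : bool := all is_const (aargs a).

Record database : Type := Database {
  db_atoms :> {fset atom};
  db_facts : all is_fact (enum_fset db_atoms) }.

(* The requirement that h maps terms of A to terms of B follows from the last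
   condition, as all atoms have positive arity; values of h on terms that do
   not occur in A are irrelevant. *)
Definition homomorphism (A B : set atom) (h : term -> term) : Prop :=
  (forall c, h (Const c) = Const c) /\ (forall a, A a -> B (map_atom h a)).

(* The quantifier prefix of a TGD is determined by its body and head. *)
Definition is_tgd (s : {fset atom} * {fset atom}) : bool :=
  [&& s.1 != fset0, s.2 != fset0,
      all (fun a => all is_var (aargs a)) (enum_fset s.1)
    & all (fun a => all is_var (aargs a)) (enum_fset s.2)].

Record tgd : Type := Tgd {
  tgd_val : {fset atom} * {fset atom};
  tgdP : is_tgd tgd_val }.
HB.instance Definition _ := [isSub for tgd_val].
HB.instance Definition _ := [Countable of tgd by <:].

Definition body (s : tgd) : {fset atom} := (tgd_val s).1.
Definition head (s : tgd) : {fset atom} := (tgd_val s).2.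

Definition vars (A : {fset atom}) : {fset nat} :=
  (\bigcup_(a <- A)
     [fset x in pmap (fun t => if t is Var x then Some x else None)
                     (aargs a)])%fset.

Definition frontier (s : tgd) : {fset nat} := (vars (body s) `&` vars (head s))%fset.

Definition simple_linear (s : tgd) : Prop :=
  exists2 a : atom, body s = [fset a]%fset & uniq (aargs a).

Definition sch (S : {fset tgd}) : {fset predicate} :=
  (\bigcup_(s <- S) [fset apred a | a in (body s `|` head s)])%fset.

Definition ar (S : {fset tgd}) : nat := \max_(p <- sch S) arity p.

(* h restricted to the frontier of s *)
Definition frontier_restr (s : tgd) (h : term -> term) : {fmap nat -> term} :=
  [fmap x : frontier s => h (Var (val x))]%fmap.

(* The null named by a variable, a TGD and a frontier assignment: pickle is an
   injection of the countable type of such triples into nat. *)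
Definition named_null (x : nat) (s : tgd) (f : {fmap nat -> term}) : term :=
  Null (choice.pickle (x, s, f)).

Lemma named_null_inj x s f x' s' f' :
  named_null x s f = named_null x' s' f' -> [/\ x = x', s = s' & f = f'].
Proof. by case=> /(pcan_inj choice.pickleK) [-> -> ->]. Qed.

Definition result_map (s : tgd) (h : term -> term) (t : term) : term :=
  if t is Var x then
    if x \in frontier s then h (Var x)
    else named_null x s (frontier_restr s h)
  else t.

Local Open Scope classical_set_scope.

Definition result (s : tgd) (h : term -> term) : set atom :=
  map_atom (result_map s h) @` [set` head s].

(* Instances are plain sets of atoms: those reachable from a database contain
   no variables, since TGDs are constant-free and heads are instantiated by
   terms of the instance and nulls. *)
Definition trigger (S : {fset tgd}) (I : set atom) (s : tgd)
    (h : term -> term) : Prop :=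
  s \in S /\ homomorphism [set` body s] I h.

Definition active (S : {fset tgd}) (I : set atom) (s : tgd)
    (h : term -> term) : Prop :=
  trigger S I s h /\ ~ (result s h `<=` I).

Definition chase_step (S : {fset tgd}) (I J : set atom) : Prop :=
  exists s h, active S I s h /\ J = I `|` result s h.

(* The derivation I 0, ..., I k; values of I beyond k are irrelevant. *)
Definition finite_valid_derivation (D : database) (S : {fset tgd}) (k : nat)
    (I : nat -> set atom) : Prop :=
  [/\ I 0 = [set` db_atoms D],
      forall i, i < k -> chase_step S (I i) (I i.+1)
    & forall s h, ~ active S (I k) s h].

Definition infinite_valid_derivation (D : database) (S : {fset tgd})
    (I : nat -> set atom) : Prop :=
  [/\ I 0 = [set` db_atoms D],
      forall i, chase_step S (I i) (I i.+1)
    & forall i s h, active S (I i) s h ->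
        exists2 j, i < j & ~ active S (I j) s h].

Definition chase_result (D : database) (S : {fset tgd}) (X : set atom) : Prop :=
  (exists k I, finite_valid_derivation D S k I /\
               X = \bigcup_(i in [set i | i <= k]) I i) \/
  (exists I, infinite_valid_derivation D S I /\ X = \bigcup_i I i).

Section Uniqueness.
Variables (D : database) (S : {fset tgd}).

Let closed (Y : set atom) : Prop :=
  [set` db_atoms D] `<=` Y /\ forall s h, trigger S Y s h -> result s h `<=` Y.

Let trigger_mono (I J : set atom) s h :
  I `<=` J -> trigger S I s h -> trigger S J s h.
Proof. by move=> IJ [sS [hC hb]]; split=> //; split=> // a /hb /IJ. Qed.

Let step_mono I J : chase_step S I J -> I `<=` J.
Proof. by move=> [s [h [_ ->]]] a; left. Qed.

Let steps_mono (I : nat -> set atom) k :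
  (forall i, i < k -> chase_step S (I i) (I i.+1)) ->
  forall i j, i <= j -> j <= k -> I i `<=` I j.
Proof.
move=> st i; elim=> [|j IH]; first by rewrite leqn0 => /eqP-> _ a.
rewrite leq_eqVlt => /orP[/eqP-> _ a //|]; rewrite ltnS => ij jk.
exact: subset_trans (IH ij (ltnW jk)) (step_mono (st _ jk)).
Qed.

Let steps_closed (I : nat -> set atom) k Y :
  I 0 = [set` db_atoms D] ->
  (forall i, i < k -> chase_step S (I i) (I i.+1)) -> closed Y -> I k `<=` Y.
Proof.
move=> I0 st [DY cY]; elim: k st => [|k IH] st; first by rewrite I0.
have {}IH : I k `<=` Y by apply: IH => i ik; apply: st; apply: ltnW.
have [s [h [[tr _] ->]]] := st k (ltnSn k) => a [/IH //|].
exact: (cY _ _ (trigger_mono IH tr)).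
Qed.

Let chase_result_sub X Y : chase_result D S X -> closed Y -> X `<=` Y.
Proof.
move=> [[k [I [[I0 st _] ->]]]|[I [[I0 st _] ->]]] cY a [i ik Ia].
  apply: (steps_closed (k := i) I0 _ cY Ia) => j ji.
  exact: st (leq_trans ji ik).
by apply: (steps_closed (k := i) I0 _ cY Ia) => j _; apply: st.
Qed.

Let finite_stage (I : nat -> set atom) (f : atom -> atom) (A : seq atom) :
  (forall i j, i <= j -> I i `<=` I j) ->
  (forall a, a \in A -> (\bigcup_i I i) (f a)) ->
  exists i, forall a, a \in A -> I i (f a).
Proof.
move=> mono; elim: A => [|a A IH] sub; first by exists 0.
have [|i Hi] := IH; first by move=> b bA; apply: sub; rewrite inE bA orbT.
have [|j _ Hj] := sub a; first by rewrite inE eqxx.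
exists (maxn i j) => b; rewrite inE => /orP[/eqP->|/Hi].
  exact: mono (leq_maxr i j) _ Hj.
exact: mono (leq_maxl i j) _.
Qed.

Let chase_result_closed X : chase_result D S X -> closed X.
Proof.
move=> [[k [I [[I0 st na] ->]]]|[I [[I0 st fair] ->]]].
  have UE : \bigcup_(i in [set i | i <= k]) I i = I k.
    apply/seteqP; split=> [a [i ik]|a Ia]; last by exists k => //=.
    exact: (steps_mono st ik (leqnn k)).
  rewrite UE; split=> [|s h tr].
    by rewrite -I0; apply: (steps_mono st).
  by apply: contrapT => nsub; apply: (na s h); split.
have mono i j : i <= j -> I i `<=` I j.
  by move=> ij; apply: (@steps_mono I j) => // l _; apply: st.
split=> [|s h [sS [hC hb]]]; first by rewrite -I0 => a Ia; exists 0.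
have [|i Hi] := @finite_stage I (map_atom h) (enum_fset (body s)) mono.
  by move=> a aA; apply: hb.
have tr j : i <= j -> trigger S (I j) s h.
  by move=> ij; split=> //; split=> // a aA; apply: (mono _ _ ij); apply: Hi.
have [sub|nsub] := pselect (result s h `<=` I i).
  by move=> a /sub Ia; exists i.
have [|j ij nact] := fair i s h; first by split=> //; apply: tr.
have sub : result s h `<=` I j.
  by apply: contrapT => ns; apply: nact; split=> //; apply: tr (ltnW ij).
by move=> a /sub Ia; exists j.
Qed.

Lemma chase_result_unique X Y :
  chase_result D S X -> chase_result D S Y -> X = Y.
Proof.
move=> cX cY; apply/seteqP; split; apply: chase_result_sub => //;
  exact: chase_result_closed.
Qed.

End Uniqueness.

(* Well defined by chase_result_unique; set0 is only the junk value of
   xget in the absence of valid derivations. *)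
Definition chase (D : database) (S : {fset tgd}) : set atom :=
  xget set0 [set X | chase_result D S X].

Lemma chaseE D S X : chase_result D S X -> chase D S = X.
Proof.
move=> cX; apply: chase_result_unique (cX).
by rewrite /chase; case: xgetP => [Y _ //|/(_ X)].
Qed.

Definition CT (D : database) (S : {fset tgd}) : Prop := finite_set (chase D S).

(* Main.v *)
(* D_l consists of l facts over a unary predicate P_0, and P_1, ..., P_n have
   arity m.  For i < n the TGD
     P_i(x) -> exists z_1 ... z_m, P_i(x) /\ (conjunction over all selections
                                   f : [m] -> [m] of P_{i+1}(z_f(1), ..., z_f(m)))
   creates from each P_i-atom m fresh nulls and m^m atoms over them.  All
   variables of its body are in the frontier, so distinct P_i-atoms create
   disjoint sets of nulls, and the number of P_i-atoms is l * m^(i * m).  The set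
   of all these atoms, i <= n, is finite and closed under triggers, hence the
   chase terminates inside it. *)
Require Import Defs.
From mathcomp Require Import all_boot finmap zify.
From mathcomp Require Import boolp classical_sets cardinality.

Set Implicit Arguments.
Unset Strict Implicit.
Unset Printing Implicit Defensive.

Local Open Scope classical_set_scope.

(** * Finite images, atoms and results of triggers *)

Lemma imfset_iotaP (K : choiceType) (f : nat -> K) (n : nat) (x : K) :
  reflect (exists2 i, i < n & x = f i) (x \in [fset f i | i in iota 0 n]%fset).
Proof.
by apply: (iffP (imfsetP _ _ _ _)) => -[i]; rewrite /= ?mem_iota => lt ->;
  exists i; rewrite //= mem_iota.
Qed.

Lemma card_imfset_iota (K : choiceType) (f : nat -> K) (n : nat) :
  injective f -> #|` [fset f i | i in iota 0 n]%fset|%fset = n.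
Proof. by move=> fI; rewrite card_imfset //= undup_id ?iota_uniq // size_iota. Qed.

Lemma atom_eq (a b : atom) : apred a = apred b -> aargs a = aargs b -> a = b.
Proof.
case: a b => [p t] [q u]; rewrite /apred /aargs /= => pq; case: _ / pq u => u tu.
by congr (Tagged _ _); apply: val_inj.
Qed.

Lemma size_aargs (a : atom) : size (aargs a) = arity (apred a).
Proof. exact: size_tuple. Qed.

Lemma varsP (A : {fset atom}) (x : nat) :
  reflect (exists2 a, a \in A & Var x \in aargs a) (x \in vars A).
Proof.
rewrite /vars; apply: (iffP idP) => [/bigfcupP[a /andP[aA _]]|[a aA xa]].
  by rewrite inE /= mem_pmap => /mapP[[] // y ya [->]]; exists a.
apply/bigfcupP; exists a; first by rewrite aA.
by rewrite inE /= mem_pmap; apply/mapP; exists (Var x).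
Qed.

Lemma eq_in_map_atom (f g : term -> term) (a : atom) :
  {in aargs a, f =1 g} -> map_atom f a = map_atom g a.
Proof. by move=> fg; apply: atom_eq => //; apply/eq_in_map. Qed.

(** The frontier lies inside the variables of the body, and the nulls depend on the homomorphism
    only through the frontier. This permits replacing any trigger by a canonical one. *)
Lemma eq_result (s : tgd) (h k : term -> term) :
  {in vars (body s), forall x, h (Var x) = k (Var x)} -> result s h = result s k.
Proof.
move=> hk; have hkF x : x \in frontier s -> h (Var x) = k (Var x).
  by rewrite in_fsetI => /andP[/hk].
have rE : frontier_restr s h = frontier_restr s k.
  by rewrite /frontier_restr; congr FinMap; apply/ffunP => x; rewrite !ffunE; exact: hkF (fsvalP x).
congr (_ @` _); apply/funext => a; apply: eq_in_map_atom => -[] //= x _.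
by case: ifP => [/hkF //|_]; rewrite rE.
Qed.

(** * Termination inside a finite closed set *)

Definition chase_closed (S : {fset tgd}) (Y : set atom) : Prop :=
  forall s h, trigger S Y s h -> result s h `<=` Y.

(** Induction on the number of atoms of [Y] outside the current instance: closure keeps each step
    inside [Y], and an active trigger adds at least one new atom. *)
Lemma finite_derivation (S : {fset tgd}) (Y A : {fset atom}) :
  chase_closed S [set` Y] -> [set` A] `<=` [set` Y] ->
  exists k (I : nat -> set atom),
    [/\ I 0 = [set` A], forall i, i < k -> chase_step S (I i) (I i.+1),
        forall s h, ~ active S (I k) s h, forall i, i <= k -> I i `<=` I k
      & I k `<=` [set` Y]].
Proof.
move=> cY; have [n] := ubnP (#|` Y| - #|` A|)%fset.
elim: n A => // n IH A ltn AY.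
have [[s [h act]]|nact] := pselect (exists s h, active S [set` A] s h); last first.
  exists 0, (fun=> [set` A]); split=> // [s h act|i _ //].
  by apply: nact; exists s, h.
pose A' := (A `|` [fset map_atom (result_map s h) a | a in Defs.head s])%fset.
have A'E : [set` A'] = [set` A] `|` result s h.
  apply/seteqP; split=> a /=.
    by move=> /fsetUP[aA|/imfsetP[b /= bs ->]]; [left|right; exists b].
  move=> [aA|[b /= bs <-]]; apply/fsetUP; [by left|right].
  by apply/imfsetP; exists b.
have [[sS [hC hb]] nsub] := act.
have A'Y : [set` A'] `<=` [set` Y].
  rewrite A'E => a [/AY //|]; apply: cY; split=> //; split=> // b bs.
  exact/AY/hb.
(* Equality would put the whole result into [A], against activity. *)
have AA' : (A `<` A')%fset.
  rewrite fproperEneq fsubsetUl andbT; apply/eqP => AE; apply: nsub => a ra.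
  by rewrite AE A'E; right.
have leY : (#|` A'| <= #|` Y|)%fset.
  by apply/fsubset_leq_card/fsubsetP => a /A'Y.
have [|k [I [I0 st na mono IY]]] := IH A' _ A'Y.
  by have := fproper_ltn_card AA'; lia.
exists k.+1, (fun i => if i is j.+1 then I j else [set` A]); split=> //.
- case=> [_|i]; last exact: st.
  by exists s, h; rewrite I0 A'E.
- case=> [_|i]; last exact: mono.
  apply: subset_trans (mono 0 _) => //; rewrite I0 => a aA.
  by apply/fsetUP; left.
Qed.

(** The chase is the last instance of a finite derivation. The upper bound will give finiteness;
    containing the database and being closed will give the lower bound on its size. *)
Lemma chase_sandwich (D : database) (S : {fset tgd}) (Y : {fset atom}) :
  chase_closed S [set` Y] -> [set` db_atoms D] `<=` [set` Y] ->
  [/\ [set` db_atoms D] `<=` chase D S, chase D S `<=` [set` Y]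
    & chase_closed S (chase D S)].
Proof.
move=> cY DY; have [k [I [I0 st na mono IY]]] := finite_derivation cY DY.
have -> : chase D S = I k.
  apply: chaseE; left; exists k, I; split; first by split.
  apply/seteqP; split=> [a Ia|a [i ik]]; last exact: mono.
  by exists k => /=.
split=> // [|s h tr]; first by rewrite -I0; apply: mono.
by apply: contrapT => nsub; apply: (na s h).
Qed.

(** * The facts, predicates and TGDs of the construction *)

Definition fact (c : nat) : atom :=
  Tagged (fun p => (arity p).-tuple term) ([tuple Const c] : (arity (0, 0)).-tuple term).

Section Construction.

(* [m] is the arity minus one, as in the second component of a predicate. *)
Variable m : nat.

Definition level_pred (i : nat) : predicate := if i is 0 then (0, 0) else (i, m).

Lemma level_pred_inj : injective level_pred.
Proof. by case=> [|i] [|j] //=; case=> // ->. Qed.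

Lemma arity_level_pred i : arity (level_pred i) <= m.+1.
Proof. by case: i. Qed.

Notation selection := (m.+1.-tuple 'I_m.+1).

Definition body_atom (i : nat) : atom :=
  Tagged (fun p => (arity p).-tuple term)
    [tuple of mkseq Var (arity (level_pred i))].

(* The variables [Var j] with [j > m] do not occur in [body_atom i], hence are
   existentially quantified. *)
Definition head_atom (i : nat) (f : selection) : atom :=
  Tagged (fun p => (arity p).-tuple term)
    ([tuple of map (fun j : 'I_m.+1 => Var (m.+1 + j)) f]
       : (arity (level_pred i.+1)).-tuple term).

(* Repeating the body atom in the head puts all its variables into the
   frontier, so the nulls determine the body atom that created them. *)
Definition level_sides (i : nat) : {fset atom} * {fset atom} :=
  ([fset body_atom i],
   body_atom i |` [fset head_atom i f | f in {: selection}])%fset.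

Lemma level_sidesP i : is_tgd (level_sides i).
Proof.
have bv : all is_var (aargs (body_atom i)).
  by apply/allP => t /mapP[j _ ->].
apply/and4P; split.
- by apply/fset0Pn; exists (body_atom i); rewrite inE.
- by apply/fset0Pn; exists (body_atom i); rewrite !inE eqxx.
- by apply/allP => a; rewrite inE => /eqP->.
apply/allP => a /fset1UP[->//|/imfsetP[f _ ->]].
by apply/allP => t /mapP[j _ ->].
Qed.

Definition level_tgd (i : nat) : tgd := Tgd (level_sidesP i).

Lemma head_level_tgdP i a :
  a \in Defs.head (level_tgd i) <-> a = body_atom i \/ exists f, a = head_atom i f.
Proof.
split=> [/fset1UP[->|/imfsetP[f _ ->]]|[->|[f ->]]]; first by left.
- by right; exists f.
- by apply/fset1UP; left.
- by apply/fset1UP; right; apply/imfsetP; exists f.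
Qed.

Lemma vars_body i x :
  (x \in vars (body (level_tgd i))) = (x < arity (level_pred i)).
Proof.
apply/varsP/idP => [[a]|lex].
  by rewrite inE => /eqP-> /mapP[j]; rewrite mem_iota add0n => jm [->].
exists (body_atom i); first by rewrite inE.
by apply/mapP; exists x; rewrite // mem_iota.
Qed.

Lemma frontier_level_tgd i x :
  (x \in frontier (level_tgd i)) = (x < arity (level_pred i)).
Proof.
rewrite in_fsetI vars_body; apply: andb_idr => lex; apply/varsP.
exists (body_atom i); first by apply/head_level_tgdP; left.
by apply/mapP; exists x; rewrite // mem_iota.
Qed.

(** * Canonical triggers and the atoms they create *)

Definition assign (a : atom) (t : term) : term :=
  if t is Var j then nth t (aargs a) j else t.

Definition child (i : nat) (a : atom) (f : selection) : atom :=
  map_atom (result_map (level_tgd i) (assign a)) (head_atom i f).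

Definition level_null (i : nat) (a : atom) (j : nat) : term :=
  named_null (m.+1 + j) (level_tgd i) (frontier_restr (level_tgd i) (assign a)).

Lemma aargs_child i a f :
  aargs (child i a f) = [seq level_null i a (nat_of_ord j) | j <- f].
Proof.
rewrite /child /aargs /= -map_comp; apply: eq_map => j /=.
(* The index [m.+1 + j] is at least the arity of the body, so the variable is outside the frontier
   and becomes a null. *)
by rewrite frontier_level_tgd ltnNge (leq_trans (arity_level_pred i)) // leq_addr.
Qed.

Lemma map_assign_body i a : apred a = level_pred i ->
  map_atom (assign a) (body_atom i) = a.
Proof.
move=> pa; apply: atom_eq => //.
rewrite -[LHS]/(map (assign a) (map Var (iota 0 (arity (level_pred i))))) -map_comp.
have sE : size (aargs a) = arity (level_pred i) by rewrite size_aargs pa.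
apply: (@eq_from_nth _ (Var 0)); rewrite size_map size_iota // => j lt.
by rewrite (nth_map 0) ?size_iota // nth_iota //= (set_nth_default (Var 0)) ?sE.
Qed.

(** The name of a null records its variable, which gives back an entry of the selection, and the
    frontier assignment, which lists all arguments of the parent. *)
Lemma child_inj i a b f g :
  apred a = level_pred i -> apred b = level_pred i ->
  child i a f = child i b g -> a = b /\ f = g.
Proof.
move=> pa pb /(congr1 aargs); rewrite !aargs_child => E.
have nE j : tnth f j = tnth g j /\
    frontier_restr (level_tgd i) (assign a) =
    frontier_restr (level_tgd i) (assign b).
  have := congr1 (fun s => nth (Var 0) s j) E.
  rewrite !(nth_map ord0) ?size_tuple // -!tnth_nth => /named_null_inj[e _ r].
  by split=> //; apply: ord_inj; apply: addnI e.
split; last by apply: eq_from_tnth => j; case: (nE j).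
(* Every null carries the same frontier assignment; position 0 exists because the arity is
   positive. *)
have [_ rE] := nE ord0; apply: atom_eq; first by rewrite pa.
apply: (@eq_from_nth _ (Var 0)) => [|j]; rewrite size_aargs pa ?size_aargs ?pb // => lt.
have jF : j \in frontier (level_tgd i) by rewrite frontier_level_tgd.
have := congr1 (fun r : {fmap nat -> term} => r.[? j]%fmap) rE.
rewrite /frontier_restr !(in_fnd jF) /= !ffunE /= => -[].
by rewrite !(set_nth_default (Var 0) (Var j)) ?size_aargs ?pa ?pb.
Qed.

Lemma result_assignP i a b : apred a = level_pred i ->
  result (level_tgd i) (assign a) b <-> b = a \/ exists f, b = child i a f.
Proof.
move=> pa; have bE : map_atom (result_map (level_tgd i) (assign a)) (body_atom i) = a.
  rewrite -[RHS](map_assign_body pa); apply: eq_in_map_atom => _ /mapP[j jm ->].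
  by rewrite /= frontier_level_tgd; move: jm; rewrite mem_iota => /= ->.
split=> [[c /= /head_level_tgdP[->|[f ->]] <-]|[->|[f ->]]].
- by left.
- by right; exists f.
- by exists (body_atom i) => //=; apply/head_level_tgdP; left.
- by exists (head_atom i f) => //=; apply/head_level_tgdP; right; exists f.
Qed.

(** Reduces an arbitrary trigger to the canonical one on the image of the body atom, so
    [result_assignP] applies to all triggers. *)
Lemma result_homomorphism i h :
  result (level_tgd i) h = result (level_tgd i) (assign (map_atom h (body_atom i))).
Proof.
apply: eq_result => x; rewrite vars_body => lex.
rewrite -[RHS]/(nth (Var x) (map h (map Var (iota 0 (arity (level_pred i))))) x).
by rewrite -map_comp (nth_map 0) ?size_iota // nth_iota.
Qed.

(** * Levels of the chase: their sizes, and bounds from above and below *)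

Definition level_tgds (n : nat) : {fset tgd} := [fset level_tgd i | i in iota 0 n]%fset.

Lemma level_tgdsP n s : reflect (exists2 i, i < n & s = level_tgd i) (s \in level_tgds n).
Proof. exact: imfset_iotaP. Qed.

Fixpoint level (l i : nat) : seq atom :=
  if i is j.+1 then [seq child j a f | a <- level l j, f <- enum {: selection}]
  else [seq fact c | c <- iota 0 l].

Lemma apred_level l i a : a \in level l i -> apred a = level_pred i.
Proof. by case: i => [/mapP[c _ ->]|i /allpairsP[[b f] [_ _ ->]]]. Qed.

Lemma level_uniq l i : uniq (level l i).
Proof.
elim: i => [|i IH]; first by rewrite map_inj_uniq ?iota_uniq // => c d [].
apply: allpairs_uniq => //; first exact: enum_uniq.
move=> _ _ /allpairsP[[a f] /= [ai _ ->]] /allpairsP[[b g] /= [bi _ ->]].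
by case/(child_inj (apred_level ai) (apred_level bi)) => -> ->.
Qed.

(** Each atom has one child per selection, and there are [m.+1 ^ m.+1] selections. *)
Lemma size_level l i : size (level l i) = l * m.+1 ^ (i * m.+1).
Proof.
elim: i => [|i IH]; first by rewrite size_map size_iota muln1.
by rewrite size_allpairs IH -cardE card_tuple card_ord mulSn addnC expnD mulnA.
Qed.

Definition levels (l n : nat) : {fset atom} :=
  [fset a in flatten [seq level l i | i <- iota 0 n.+1]]%fset.

Lemma levelsP l n a : reflect (exists2 i, i <= n & a \in level l i) (a \in levels l n).
Proof.
apply: (iffP (imfsetP _ _ _ _)) => [[b /flatten_mapP[i]]|[i lt ai]].
  by rewrite mem_iota => lt bi ->; exists i.
by exists a => //; apply/flatten_mapP; exists i; rewrite // mem_iota.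
Qed.

(** The predicate of the body image fixes its level [i]; as [i < n], its children are still in a
    level of index at most [n]. *)
Lemma levels_closed l n : chase_closed (level_tgds n) [set` levels l n].
Proof.
move=> s h [/level_tgdsP[i lt ->] [_ hb]] b; rewrite result_homomorphism.
have /levelsP[j jn aj] : [set` levels l n] (map_atom h (body_atom i)).
  by apply: hb; rewrite /= inE.
have ij : j = i by apply: level_pred_inj; rewrite -(apred_level aj).
move: aj; rewrite ij; set a := map_atom h _ => ai.
move=> /(result_assignP _ (apred_level ai))[->|[f ->]]; apply/levelsP.
  by exists i; rewrite // ltnW.
by exists i.+1 => //; apply/allpairsP; exists (a, f); rewrite mem_enum.
Qed.

(** By induction on the level: a child belongs to the result of the canonical trigger on its parent,
    which is already in [X]. *)
Lemma level_sub_closed l n X : chase_closed (level_tgds n) X ->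
  [set` level l 0] `<=` X -> forall i, i <= n -> [set` level l i] `<=` X.
Proof.
move=> cX X0; elim=> [//|i IH] lt _ /allpairsP[[a f] /= [ai _ ->]].
have pa := apred_level ai; apply: (cX (level_tgd i) (assign a)); last first.
  by apply/(result_assignP _ pa); right; exists f.
split; first by apply/level_tgdsP; exists i.
split=> // b; rewrite /= inE => /eqP->; rewrite map_assign_body //.
exact: IH (ltnW lt) _ ai.
Qed.

(** * Simple linearity, schema and arity *)

Lemma level_tgd_simple_linear i : simple_linear (level_tgd i).
Proof.
by exists (body_atom i); rewrite // map_inj_uniq ?iota_uniq // => x y [].
Qed.

Lemma sch_level_tgds n :
  0 < n -> sch (level_tgds n) = [fset level_pred i | i in iota 0 n.+1]%fset.
Proof.
move=> n0; apply/fsetP => p; apply/idP/imfset_iotaP.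
  case/bigfcupP=> s /andP[/level_tgdsP[i lt ->] _] /imfsetP[a /= aB ->].
  have : a = body_atom i \/ exists f, a = head_atom i f.
    by case/fsetUP: aB => [|/head_level_tgdP //]; rewrite inE => /eqP; left.
  by case=> [->|[f ->]]; [exists i|exists i.+1]; rewrite // ltnS ltnW.
case=> i lt ->; apply/bigfcupP.
case: i lt => [|i] lt.
  exists (level_tgd 0); first by rewrite andbT; apply/level_tgdsP; exists 0.
  by apply/imfsetP; exists (body_atom 0); rewrite //= !inE eqxx.
exists (level_tgd i); first by rewrite andbT; apply/level_tgdsP; exists i.
(* Any selection would do; the constant one shows that the predicate occurs in the head. *)
apply/imfsetP; exists (head_atom i (nseq_tuple _ ord0)) => //=.
by apply/fsetUP; right; apply/head_level_tgdP; right; eexists.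
Qed.

Lemma card_sch_level_tgds n : 0 < n -> (#|` sch (level_tgds n)| = n.+1)%fset.
Proof.
by move=> n0; rewrite sch_level_tgds // card_imfset_iota //; apply: level_pred_inj.
Qed.

Lemma ar_level_tgds n : 0 < n -> ar (level_tgds n) = m.+1.
Proof.
move=> n0; rewrite /ar; apply/eqP; rewrite eqn_leq; apply/andP; split.
  apply/bigmax_leqP_seq => p; rewrite sch_level_tgds // => /imfset_iotaP[i _ ->] _.
  exact: arity_level_pred.
(* The maximum is attained at index 1, which is in the schema since [0 < n]; index 0 is unary. *)
rewrite -[m.+1]/(arity (level_pred 1)); apply: leq_bigmax_seq => //.
by rewrite sch_level_tgds //; apply/imfset_iotaP; exists 1.
Qed.

End Construction.

(** * The databases and the final count *)

Lemma factsP (l : nat) :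
  all is_fact (enum_fset [fset fact c | c in iota 0 l]%fset).
Proof. by apply/allP => a /imfsetP[c _ ->]. Qed.

Definition facts (l : nat) : database := Database (factsP l).

Lemma card_facts l : (#|` facts l| = l)%fset.
Proof. by apply: card_imfset_iota => c d []. Qed.

Theorem theorem6p5 :
  exists (D : nat -> database) (Sigma : nat -> nat -> {fset tgd}),
    forall l n m : nat, 0 < l -> 0 < n -> 0 < m ->
      [/\ (#|` D l| = l)%fset,
          (forall s, s \in Sigma n m -> simple_linear s),
          (n = #|` sch (Sigma n m)| - 1)%fset,
          m = ar (Sigma n m)
        & CT (D l) (Sigma n m) /\
          (l * m ^ (n * m) <= #|` fset_set (chase (D l) (Sigma n m))|)%fset].
Proof.
(* The predecessor appears because the construction is parametrised by the arity minus one. *)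
exists facts, (fun n m => level_tgds m.-1 n) => l n [//|m] _ n0 _ /=.
have DE : [set` db_atoms (facts l)] = [set` level m l 0].
  apply/seteqP; split=> a /=; first by move=> /imfsetP[c /= ci ->]; apply: map_f.
  by case/mapP=> c ci ->; apply/imfsetP; exists c.
have [|DX XY cX] := @chase_sandwich (facts l) _ _ (@levels_closed m l n).
  by rewrite DE => a a0; apply/levelsP; exists 0.
have fin : CT (facts l) (level_tgds m n).
  exact: sub_finite_set XY (finite_fset _).
split; last split=> //.
- exact: card_facts.
- by move=> s /level_tgdsP[i _ ->]; apply: level_tgd_simple_linear.
- by rewrite card_sch_level_tgds // subn1.
- by rewrite ar_level_tgds.
(* The last level alone has the required number of distinct atoms. *)
rewrite -size_level; apply: uniq_leq_size (level_uniq _ _ _) _ => a an.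
rewrite in_fset_set // inE; apply: (level_sub_closed cX) (leqnn n) _ an.
by rewrite -DE.
Qed.
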